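(* Let $W\in C^2_{\mathrm{loc}}(\mathbb{R}^N)$ and let $a^\pm$ be local minima of $W$ with $W(a^-)<0=W(a^+)$, $a^-$ a global minimum of $W$, and $W^{-1}([W(a^-),0])$ compact in $\mathbb{R}^N$. Let $r_0>0$ be such that $W(u)\ge0$ for $|u-a^+|\le r_0$ and $W(u)<0$ for $|u-a^-|\le r_0$. If $L>0$ and $c>0$ are fixed, then there exists $U_L\in\mathcal{X}_L$ with \[ E_c(U_L)=\inf_{V\in\mathcal{X}_L}E_c(V). \]
   Context: For $c>0$ and $U\in[H^1_{\mathrm{loc}}(\mathbb{R})]^N$, $E_c(U):=\int_{\mathbb{R}}\big(\tfrac12|U_x|^2+W(U)\big)e^{cx}\,dx$. $\mathcal{X}_L:=\{U\in[H^1_{\mathrm{loc}}(\mathbb{R})]^N: |U(x)-a^+|\le r_0 \text{ for } x\ge L,\ |U(x)-a^-|\le r_0 \text{ for } x\le -L\}$ (pointwise values via the continuous representative). *)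

(* Defs.v *)
From HB Require Import structures.
From mathcomp Require Import all_boot all_order all_algebra.
From mathcomp Require Import all_classical all_reals all_analysis.
Set Implicit Arguments. Unset Strict Implicit. Unset Printing Implicit Defensive.
Import Order.TTheory GRing.Theory Num.Theory.
Import numFieldNormedType.Exports.
Local Open Scope classical_set_scope.
Local Open Scope ring_scope.

Section Defs.
Variable R : realType.
Variable N : nat.

Definition eucl_norm (v : 'rV[R]_N) : R := Num.sqrt (\sum_(i < N) v ord0 i ^+ 2).

Definition ebasis (i : 'I_N) : 'rV[R]_N := delta_mx ord0 i.

Definition C2 (W : 'rV[R]_N -> R) : Prop :=
  continuous W /\
  (forall i x, derivable W x (ebasis i)) /\
  (forall i, continuous ('D_(ebasis i) W)) /\
  (forall i j x, derivable ('D_(ebasis i) W) x (ebasis j)) /\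
  (forall i j, continuous ('D_(ebasis j) ('D_(ebasis i) W))).

Definition local_min (W : 'rV[R]_N -> R) (a : 'rV[R]_N) : Prop :=
  \forall u \near a, W a <= W u.

Definition global_min (W : 'rV[R]_N -> R) (a : 'rV[R]_N) : Prop :=
  forall u, W a <= W u.

(* g is a weak derivative of f : R -> R with g in L^2_loc, i.e.
   f is (the continuous representative of) an H^1_loc(R) function. *)
Definition is_wderiv (f g : R -> R) : Prop :=
  measurable_fun setT g /\
  forall a b : R, a <= b ->
    (lebesgue_measure : measure _ R).-integrable `[a, b] (fun x => (g x ^+ 2)%:E) /\
    (lebesgue_measure : measure _ R).-integrable `[a, b] (fun x => (g x)%:E) /\
    f b - f a = Rintegral lebesgue_measure `[a, b] g.

Definition H1loc_scalar (f : R -> R) : Prop := exists g, is_wderiv f g.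

(* U in [H^1_loc(R)]^N, U taken as its continuous representative *)
Definition H1loc (U : R -> 'rV[R]_N) : Prop :=
  forall i : 'I_N, H1loc_scalar (fun x => U x ord0 i).

(* the weak derivative (unique a.e.; a choice of representative) *)
Definition wderiv (f : R -> R) : R -> R :=
  match pselect (exists g, is_wderiv f g) with
  | left h => projT1 (cid h)
  | right _ => fun _ => 0
  end.

Definition grad_sq (U : R -> 'rV[R]_N) (x : R) : R :=
  \sum_(i < N) (wderiv (fun y => U y ord0 i) x) ^+ 2.

Definition Ec (W : 'rV[R]_N -> R) (c : R) (U : R -> 'rV[R]_N) : \bar R :=
  (\int[lebesgue_measure]_x
     (((2%:R)^-1 * grad_sq U x + W (U x)) * expR (c * x))%:E)%E.

Definition XL (ap am : 'rV[R]_N) (r0 L : R) (U : R -> 'rV[R]_N) : Prop :=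
  H1loc U /\
  (forall x, L <= x -> eucl_norm (U x - ap) <= r0) /\
  (forall x, x <= - L -> eucl_norm (U x - am) <= r0).

End Defs.

(* Main.v *)
(** The direct method.  Along a minimizing sequence the weighted energies of the
    weak derivatives are bounded, so by Young's inequality the functions are
    equicontinuous and pointwise bounded, the constraint at [x = L] providing the
    anchor; a subsequence converges pointwise, and the constraints pass to the
    limit.  Lower semicontinuity of the kinetic part replaces weak compactness in
    L^2 by an elementary argument: among pairs (function, weak derivative) that are
    at least as close to the limit as the tail of the sequence, a minimizing
    sequence of derivatives is Cauchy by the parallelogram law, and its strong
    limit is a weak derivative of the pointwise limit.  The potential part is
    handled by Fatou's lemma, since the negative part of W(U) e^{cx} is dominated
    by the integrable function |W(a^-)| e^{cx} on ]-oo, L]. *)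

Require Import Defs.
From HB Require Import structures.
From mathcomp Require Import all_boot all_order all_algebra.
From mathcomp Require Import all_classical all_reals all_analysis.
From mathcomp Require Import measurable_realfun.
From mathcomp Require Import ring lra.
Import Order.TTheory GRing.Theory Num.Theory.
Import numFieldNormedType.Exports.
Local Open Scope classical_set_scope.
Local Open Scope ring_scope.

Set Implicit Arguments.
Unset Strict Implicit.
Unset Printing Implicit Defensive.

(** * Weighted kinetic energy and Young's inequality on segments *)

Section weighted_energy.
Context {R : realType}.
Local Notation mu := (@lebesgue_measure R).
Implicit Types (f g : R -> R) (c a b : R).

Definition wenergy c g : \bar R := (\int[mu]_x (g x ^+ 2 * expR (c * x))%:E)%E.

Lemma measurable_expR_scale (c : R) : measurable_fun setT (fun x : R => expR (c * x)).
Proof. by apply: measurableT_comp => //; exact: mulrl_measurable. Qed.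

Lemma measurable_wenergy c g : measurable_fun setT g ->
  measurable_fun setT (fun x => (g x ^+ 2 * expR (c * x))%:E).
Proof.
move=> mg; apply/measurable_EFinP; apply: measurable_funM.
  exact: measurable_funX.
exact: measurable_expR_scale.
Qed.

Lemma wenergy_ge0 c g : (0 <= wenergy c g)%E.
Proof.
by apply: integral_ge0 => x _; rewrite lee_fin mulr_ge0 ?sqr_ge0 ?expR_ge0.
Qed.

Lemma sqr_le_weighted c a x (y : R) : 0 < c -> a <= x ->
  y ^+ 2 <= expR (- (c * a)) * (y ^+ 2 * expR (c * x)).
Proof.
move=> c0 ax; rewrite mulrCA -expRD ler_peMr ?sqr_ge0//.
by rewrite -expR0 ler_expR addrC subr_ge0 ler_pM2l.
Qed.

(** The weight is increasing, so on the segment it is at least its value at the left endpoint. *)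
Lemma integral_sqr_le_wenergy c g a b : 0 < c -> measurable_fun setT g ->
  (\int[mu]_(x in `[a, b]) (g x ^+ 2)%:E <= (expR (- (c * a)))%:E * wenergy c g)%E.
Proof.
move=> c0 mg; rewrite /wenergy -ge0_integralZl_EFin//; last 2 first.
- by move=> x _; rewrite lee_fin mulr_ge0 ?sqr_ge0 ?expR_ge0.
- exact: measurable_wenergy.
apply: (@le_trans _ _ (\int[mu]_(x in `[a, b]) ((expR (- (c * a)))%:E * (g x ^+ 2 * expR (c * x))%:E))%E).
  apply: ge0_le_integral => //.
  - by move=> x _; rewrite lee_fin sqr_ge0.
  - apply: measurable_funTS; apply/measurable_EFinP; exact: measurable_funX.
  - apply: measurable_funTS; apply: emeasurable_funM => //.
    exact: measurable_wenergy.
  - move=> x /=; rewrite in_itv/= => /andP[ax _].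
    by rewrite -EFinM lee_fin sqr_le_weighted.
apply: ge0_subset_integral => //.
- apply: emeasurable_funM => //; exact: measurable_wenergy.
- by move=> x _; rewrite -EFinM lee_fin mulr_ge0 ?expR_ge0// mulr_ge0 ?sqr_ge0 ?expR_ge0.
Qed.

Lemma integrable_itv_cst (k a b : R) : mu.-integrable `[a, b] (fun=> k%:E).
Proof.
apply: (@continuous_compact_integrable _ (fun=> k)); first exact: segment_compact.
by apply: continuous_subspaceT => x; exact: cst_continuous.
Qed.

Lemma integrable_of_sqr_integrable g a b : measurable_fun setT g ->
  mu.-integrable `[a, b] (fun x => (g x ^+ 2)%:E) ->
  mu.-integrable `[a, b] (fun x => (g x)%:E).
Proof.
move=> mg ig.
have i1 : mu.-integrable `[a, b] (fun x => (1 + g x ^+ 2)%:E).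
  exact: (integrableD _ (integrable_itv_cst 1 a b) ig).
apply: (le_integrable _ _ _ i1) => //.
  by apply: measurable_funTS; exact/measurable_EFinP.
move=> x _ /=; rewrite lee_fin.
rewrite [leRHS]ger0_norm ?addr_ge0 ?sqr_ge0//.
have := sqr_ge0 (`|g x| - 1); rewrite sqrrB real_normK ?num_real// expr1n mulr1 => h.
have := normr_ge0 (g x); move: h; rewrite mulr2n.
set p := `|g x|; set q := g x ^+ 2; lra.
Qed.

(** Integrates the pointwise bound [|g| <= t / 2 * g ^+ 2 + 1 / (2 * t)], which expands
    [(t * |g| - 1) ^+ 2 >= 0]. It stands in for Cauchy-Schwarz, with [t] left free to be tuned
    later. *)
Lemma Rintegral_Young g a b t : a <= b -> 0 < t -> measurable_fun setT g ->
  mu.-integrable `[a, b] (fun x => (g x ^+ 2)%:E) ->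
  `|Rintegral mu `[a, b] g| <=
    t / 2 * Rintegral mu `[a, b] (fun x => g x ^+ 2) + (b - a) / (2 * t).
Proof.
move=> ab t0 mg ig; have ig1 := integrable_of_sqr_integrable mg ig.
have iz (k : R) : mu.-integrable `[a, b] (fun x => (k * g x ^+ 2)%:E).
  exact: (integrableZl _ k ig).
apply: (le_trans (le_normr_Rintegral _ ig1)) => //.
have -> : t / 2 * Rintegral mu `[a, b] (fun x => g x ^+ 2) + (b - a) / (2 * t) =
    Rintegral mu `[a, b] (fun x => t / 2 * g x ^+ 2 + 1 / (2 * t)).
  have -> : Rintegral mu `[a, b] (fun x => t / 2 * g x ^+ 2 + 1 / (2 * t)) =
      Rintegral mu `[a, b] (fun x => t / 2 * g x ^+ 2) +
      Rintegral mu `[a, b] (fun=> 1 / (2 * t)).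
    exact: (RintegralD _ (iz (t / 2)) (integrable_itv_cst (1 / (2 * t)) a b)).
  rewrite (@RintegralZl _ _ R mu `[a,b]%classic (fun x => g x ^+ 2))//.
  rewrite Rintegral_cst//= lebesgue_measure_itv/= lte_fin.
  case: ltP => [_|ba]; first by congr (_ + _); rewrite mul1r mulrC.
  by have -> : b = a by [apply/le_anti; rewrite ab ba]; rewrite subrr !mul0r mulr0.
apply: le_Rintegral => //.
- exact: (integrable_norm ig1).
- exact: (integrableD _ (iz (t / 2)) (integrable_itv_cst (1 / (2 * t)) a b)).
- move=> x _.
  rewrite -subr_ge0 -(@pmulr_rge0 _ (2 * t)) ?mulr_gt0//.
  have -> : 2 * t * (t / 2 * g x ^+ 2 + 1 / (2 * t) - `|g x|) = (t * `|g x| - 1) ^+ 2.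
    by rewrite -[g x ^+ 2]real_normK ?num_real//; field; rewrite gt_eqF.
  exact: sqr_ge0.
Qed.

End weighted_energy.

(** * Weak derivatives: modulus of continuity, uniqueness, linearity *)

Section weak_derivative.
Context {R : realType}.
Local Notation mu := (@lebesgue_measure R).
Implicit Types (f g h : R -> R) (c a b t M : R).

Lemma wderivP f : H1loc_scalar f -> is_wderiv f (wderiv f).
Proof. by rewrite /wderiv; case: pselect => // h _; exact: (projT2 (cid h)). Qed.

(** The bound depends on [f] only through [M], hence is uniform along a sequence of bounded energy:
    this is the source of equicontinuity. *)
Lemma is_wderiv_osc c f g M a b t : 0 < c -> 0 < t -> a <= b ->
  is_wderiv f g -> (wenergy c g <= M%:E)%E ->
  `|f b - f a| <= t / 2 * (expR (- (c * a)) * M) + (b - a) / (2 * t).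
Proof.
move=> c0 t0 ab [mg fg] gM; have [ig2 [ig ->]] := fg _ _ ab.
apply: (le_trans (Rintegral_Young ab t0 mg ig2)).
rewrite lerD2r ler_pM2l ?divr_gt0// -lee_fin /Rintegral fineK; last first.
  exact: integrable_fin_num.
apply: (le_trans (integral_sqr_le_wenergy a b c0 mg)).
by rewrite EFinM lee_pmul2l// lte_fin expR_gt0.
Qed.

(** Near [x], [f] is a constant plus the integral of [g] from [x - 1], and such an integral is
    continuous inside the segment. *)
Lemma is_wderiv_continuous f g : is_wderiv f g -> continuous f.
Proof.
move=> [mg fg] x.
have x1 : x - 1 < x + 1 by lra.
have [_ [ig _]] := fg _ _ (ltW x1).
have /(continuous_within_itvP _ x1)[+ _ _] :=
  parameterized_integral_continuous (ltW x1) ig.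
have xin : x \in `]x - 1, x + 1[ by rewrite in_itv/=; apply/andP; split; lra.
move=> /(_ x xin) Fx.
have : {for x, continuous (fun y => f (x - 1) + parameterized_integral mu (x - 1) y g)}.
  by apply: cvgD => //; exact: cvg_cst.
have E y : x - 1 <= y -> f (x - 1) + parameterized_integral mu (x - 1) y g = f y.
  move=> xy; have [_ [_ e]] := fg _ _ xy.
  by rewrite /parameterized_integral -e addrC subrK.
rewrite /prop_for /continuous_at E; last lra.
apply: cvg_trans; apply: near_eq_cvg.
have : \forall y \near x, x - 1 < y.
  by apply: (@cvgr_gt _ _ (nbhs x) _ id x); [exact: cvg_id|lra].
by apply: filterS => y xy; rewrite E// ltW.
Qed.

Lemma is_wderiv_locally_integrable f g : is_wderiv f g -> locally_integrable setT g.
Proof.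
move=> [mg fg]; split => //; first exact: openT.
move=> K _ cK.
have [n [_ /(_ (`|n| + 1)) Kn]] := compact_bounded cK.
have nn : - (`|n| + 1) <= `|n| + 1 by have := normr_ge0 n; lra.
have [_ [/integrableP[_ ig] _]] := fg _ _ nn.
apply: le_lt_trans ig; apply: ge0_subset_integral => //.
- exact: compact_measurable.
- by apply: measurable_funTS; apply/measurable_EFinP; exact: measurableT_comp.
- move=> x Kx /=; rewrite in_itv/= -ler_norml; apply: Kn => //.
  by rewrite (le_lt_trans (ler_norm _))// ltrDl.
Qed.

(** At a common Lebesgue point of [g] and [h], both values are the derivative of the same primitive,
    namely [f] up to a constant. *)
Lemma is_wderiv_ae_unique f g h : is_wderiv f g -> is_wderiv f h ->
  {ae mu, forall x, g x = h x}.
Proof.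
move=> fg fh.
have := lebesgue_differentiation (is_wderiv_locally_integrable fg).
have := lebesgue_differentiation (is_wderiv_locally_integrable fh).
apply: filterS2; first exact: (ae_filter_ringOfSetsType mu).
move=> x hx gx.
have H k : is_wderiv f k -> lebesgue_pt k x ->
    (fun y => Rintegral mu `[x - 1, y] k)^`()%classic x = k x.
  move=> fk kx; have [_ /(_ (x - 1) (x + 1))[|_ [ik _]]] := fk; first by lra.
  have x1 : x < x + 1 by lra.
  by have [] := FTC1_lebesgue_pt x1 ik _ kx; first by rewrite lte_fin; lra.
rewrite -(H g)// -(H h)//; congr (_^`()%classic x); apply/funext => y.
have [xy|yx] := leP (x - 1) y.
  have [_ /(_ _ _ xy)[_ [_ <-]]] := fg.
  by have [_ /(_ _ _ xy)[_ [_ <-]]] := fh.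
(* To the left of [x - 1] the segment is empty and both integrals are 0. *)
by rewrite set_itv_ge ?bnd_simp -?ltNge// !Rintegral_set0.
Qed.

(** Makes the energy independent of the representative chosen by [wderiv]. *)
Lemma wenergy_wderiv c f g : is_wderiv f g -> wenergy c (wderiv f) = wenergy c g.
Proof.
move=> fg; have fw : is_wderiv f (wderiv f) by apply: wderivP; exists g.
apply: ge0_ae_eq_integral => //.
- by apply: measurable_wenergy; case: fw.
- by apply: measurable_wenergy; case: fg.
- by move=> x _; rewrite lee_fin mulr_ge0 ?sqr_ge0 ?expR_ge0.
- by move=> x _; rewrite lee_fin mulr_ge0 ?sqr_ge0 ?expR_ge0.
- have := is_wderiv_ae_unique fw fg.
  by apply: filterS; [exact: (ae_filter_ringOfSetsType mu)|move=> x -> _].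
Qed.

Lemma measurable_fun_lincomb k l g h : measurable_fun setT g -> measurable_fun setT h ->
  measurable_fun setT (fun x => k * g x + l * h x).
Proof.
move=> mg mh; apply: measurable_funD; exact: measurable_funM.
Qed.

Lemma is_wderiv_lincomb k l f1 f2 g1 g2 : is_wderiv f1 g1 -> is_wderiv f2 g2 ->
  is_wderiv (fun x => k * f1 x + l * f2 x) (fun x => k * g1 x + l * g2 x).
Proof.
move=> [m1 H1] [m2 H2]; have mg := measurable_fun_lincomb k l m1 m2; split => //.
move=> a b ab; have [s1 [i1 e1]] := H1 _ _ ab; have [s2 [i2 e2]] := H2 _ _ ab.
have j1 : mu.-integrable `[a, b] (fun x => (k * g1 x)%:E).
  exact: (integrableZl _ k i1).
have j2 : mu.-integrable `[a, b] (fun x => (l * g2 x)%:E).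
  exact: (integrableZl _ l i2).
split; [|split].
(* The square of the combination is dominated by twice the sum of the squares of its two terms. *)
- have t1 : mu.-integrable `[a, b] (fun x => (2 * k ^+ 2 * g1 x ^+ 2)%:E).
    exact: (integrableZl _ (2 * k ^+ 2) s1).
  have t2 : mu.-integrable `[a, b] (fun x => (2 * l ^+ 2 * g2 x ^+ 2)%:E).
    exact: (integrableZl _ (2 * l ^+ 2) s2).
  apply: (le_integrable _ _ _ (integrableD _ t1 t2)) => //.
    by apply/measurable_funTS/measurable_EFinP; exact: measurable_funX.
  move=> x _ /=; rewrite lee_fin !ger0_norm ?sqr_ge0//; last first.
    by rewrite addr_ge0// mulr_ge0 ?sqr_ge0// mulr_ge0 ?sqr_ge0.
  rewrite -subr_ge0.
  have -> : 2 * k ^+ 2 * g1 x ^+ 2 + 2 * l ^+ 2 * g2 x ^+ 2 -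
    (k * g1 x + l * g2 x) ^+ 2 = (k * g1 x - l * g2 x) ^+ 2 by ring.
  exact: sqr_ge0.
- exact: (integrableD _ j1 j2).
- have -> : Rintegral mu `[a, b] (fun x => k * g1 x + l * g2 x) =
      Rintegral mu `[a, b] (fun x => k * g1 x) + Rintegral mu `[a, b] (fun x => l * g2 x).
    exact: (RintegralD _ j1 j2).
  rewrite (@RintegralZl _ _ R mu `[a,b]%classic g1)//.
  rewrite (@RintegralZl _ _ R mu `[a,b]%classic g2)// -e1 -e2; ring.
Qed.

Lemma wenergy_parallelogram c g h : measurable_fun setT g -> measurable_fun setT h ->
  (wenergy c (fun x => 2^-1 * g x + 2^-1 * h x)%R +
   wenergy c (fun x => 2^-1 * g x + (- 2^-1) * h x)%R =
   2^-1%:E * (wenergy c g + wenergy c h))%E.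
Proof.
move=> mg mh; rewrite /wenergy -!ge0_integralD//;
  try (by apply: measurable_wenergy => //; exact: measurable_fun_lincomb);
  try (by move=> x _; rewrite lee_fin mulr_ge0 ?sqr_ge0 ?expR_ge0).
rewrite -ge0_integralZl_EFin//; first last.
- by apply: emeasurable_funD; exact: measurable_wenergy.
- by move=> x _; rewrite adde_ge0// lee_fin mulr_ge0 ?sqr_ge0 ?expR_ge0.
apply: eq_integral => x _; rewrite -!EFinD -EFinM; congr (_%:E); by field.
Qed.

End weak_derivative.

(** * Extraction of pointwise convergent subsequences *)

Section extraction.
Context {R : realType}.

(** The image of an ultrafilter is an ultrafilter; here it contains a compact segment, so it
    converges. *)
Lemma bounded_ultra_cvg (G : set_system nat) (u : nat -> R) (B : R) :
  UltraFilter G -> (forall n, `|u n| <= B) -> exists l : R, u @ G --> l.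
Proof.
move=> UG uB; have PG := @ultra_proper _ _ UG.
have [G' [UG' sG]] : exists G' : set_system R, UltraFilter G' /\ u @ G `<=` G'.
  exact: ultraFilterLemma.
have GE : u @ G = G'.
  apply/seteqP; split => // A G'A; rewrite /= /fmap/=.
  have [//|GC] := in_ultra_setVsetC (u @^-1` A) UG.
  have /sG G'C : (u @ G) (~` A) by [].
  have PG' := @ultra_proper _ _ UG'.
  by have [x []] := filter_ex (filterI G'A G'C).
have : (u @ G) `[- B, B]%classic.
  rewrite /= /fmap/=; apply: filterE => n /=.
  by rewrite in_itv/= -ler_norml.
have := @segment_compact R (- B) B; rewrite compact_ultra => /(_ _ UG').
by rewrite GE => /[apply] -[l [_ ll]]; exists l.
Qed.

(* An ultrafilter yields limits at all points simultaneously; only countably many of them are then kept by [countable_selection]. *)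
Lemma exists_limit_filter : exists G : set_system nat,
  [/\ ProperFilter G, \oo `<=` G &
    forall (u : nat -> R) B, (forall n, `|u n| <= B) -> exists l : R, u @ G --> l].
Proof.
have [G [UG sG]] := @ultraFilterLemma nat \oo _.
exists G; split => //; first exact: ultra_proper.
by move=> u B; exact: bounded_ultra_cvg.
Qed.

(** Diagonal choice: stage [k] imposes precision [1 / (k + 1)] on the indices coded below [k],
    finitely many conditions that all hold on sets of [G], hence at a common [n >= k]. The bound
    [k <= phi k] replaces strict monotonicity of [phi]. *)
Lemma countable_selection (G : set_system nat) (T : countType)
    (u : T -> nat -> R) (l : T -> R) :
  ProperFilter G -> \oo `<=` G -> (forall t, u t @ G --> l t) ->
  exists phi : nat -> nat, (forall k, (k <= phi k)%N) /\
    forall t, (u t \o phi) n @[n --> \oo] --> l t.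
Proof.
move=> PG sG ul.
have sel k : exists n, (k <= n)%N /\ forall j : 'I_k,
    if unpickle j is Some t then `|l t - u t n| < k.+1%:R^-1 else true.
  have H1 : \forall n \near G, (k <= n)%N.
    by apply: sG; exists k.
  have H2 : \forall n \near G, forall j : 'I_k,
      if unpickle j is Some t then `|l t - u t n| < k.+1%:R^-1 else true.
    apply: filter_forall => j; case: (unpickle j) => [t|]; last exact: filterE.
    by have /cvgrPdist_lt := ul t; apply; rewrite invr_gt0.
  have [n [kn Hn]] := filter_ex (filterI H1 H2).
  by exists n.
have [phi Hphi] := choice sel; exists phi; split => [k|t]; first by case: (Hphi k).
apply/cvgrPdist_lt => e e0.
near=> k.
have [_ /(_ _)] := Hphi k.
have kt : (pickle t < k)%N by near: k; exact: nbhs_infty_gt.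
move=> /(_ (Ordinal kt)); rewrite /= pickleK => /lt_le_trans; apply.
apply: ltW; near: k; exact: near_infty_natSinv_lt (PosNum e0).
Unshelve. all: by end_near. Qed.

(** A three-epsilon argument through a rational near [x]. Convergence along [G] at every point
    serves to transfer the modulus of continuity at [x] from the [v n] to [V]. *)
Lemma equicontinuous_cvg_of_rat (v : nat -> R -> R) (V : R -> R)
    (G : set_system nat) (phi : nat -> nat) :
  ProperFilter G ->
  (forall x e, 0 < e -> exists2 d, 0 < d &
    forall n y, `|y - x| < d -> `|v n y - v n x| <= e) ->
  (forall x, v^~ x @ G --> V x) ->
  (forall q : rat, v (phi n) (ratr q) @[n --> \oo] --> V (ratr q)) ->
  forall x, v (phi n) x @[n --> \oo] --> V x.
Proof.
move=> PG eqc vV vq x; apply/cvgrPdist_le => e e0.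
have e3 : 0 < e / 3 by rewrite divr_gt0.
have [d d0 Hd] := eqc x _ e3.
have [q] : exists q : rat, ratr q \in `]x, x + d[ by apply: rat_in_itvoo; rewrite ltrDl.
rewrite in_itv/= => /andP[xq qd].
have qx : `|ratr q - x| < d by rewrite ger0_norm; lra.
have VV : `|V (ratr q) - V x| <= e / 3.
  have c : (fun n => `|v n (ratr q) - v n x|) @ G --> `|V (ratr q) - V x|.
    by apply: cvg_norm; apply: cvgB; exact: vV.
  by apply: (cvgr_to_le c); apply: filterE => n; exact: Hd.
have /cvgrPdist_le/(_ _ e3) := vq q; apply: filterS => n vn.
have := Hd (phi n) _ qx.
move: VV vn; rewrite !ler_norml => /andP[? ?] /andP[? ?] /andP[? ?].
by apply/andP; split; lra.
Qed.

End extraction.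

(** * Summable increments and a form of Fatou's lemma *)

Section riesz_fischer.
Context {R : realType}.
Local Notation mu := (@lebesgue_measure R).

Lemma sum_half_le (n : nat) : \sum_(k < n) (2 ^+ k)^-1 <= 2 :> R.
Proof.
suff -> : \sum_(k < n) (2 ^+ k)^-1 = 2 - 2 * (2 ^+ n)^-1 :> R.
  by rewrite gerBl mulr_ge0// invr_ge0 exprn_ge0.
elim: n => [|n IH]; first by rewrite big_ord0 expr0 invr1 mulr1 subrr.
by rewrite big_ord_recr/= IH exprS invfM; field; rewrite expf_neq0.
Qed.

(** By AM-GM each increment is at most half of its weighted square plus half of [(r * 2 ^+ k)^-1].
    The geometric series sums to at most 2, whence the term [r^-1]. *)
Lemma summable_increments (u : nat -> R) (r tau : R) : 0 < r ->
  (forall n, \sum_(k < n) 2 ^+ k * ((u k.+1 - u k) ^+ 2 * r) <= tau) ->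
  cvgn u /\ forall n, `|u n| <= `|u 0%N| + (2^-1 * tau + r^-1).
Proof.
move=> r0 utau.
have S n : \sum_(k < n) `|u k.+1 - u k| <= 2^-1 * tau + r^-1.
  have step k : `|u k.+1 - u k| <=
      2^-1 * (2 ^+ k * ((u k.+1 - u k) ^+ 2 * r)) + 2^-1 * r^-1 * (2 ^+ k)^-1.
    have k0 : (0 : R) < 2 ^+ k by rewrite exprn_gt0.
    rewrite -subr_ge0 -(@pmulr_rge0 _ (2 * (2 ^+ k * r))) ?mulr_gt0//.
    rewrite [X in 0 <= X](_ : _ = (2 ^+ k * r * `|u k.+1 - u k| - 1) ^+ 2) ?sqr_ge0//.
    rewrite -[(u k.+1 - u k) ^+ 2]real_normK ?num_real//.
    by field; rewrite !gt_eqF.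
  apply: (le_trans (ler_sum _ (fun (k : 'I_n) _ => step k))).
  rewrite big_split/= -!mulr_sumr lerD ?ler_pM2l//; first exact: utau.
  have := sum_half_le n; have : 0 < r^-1 by rewrite invr_gt0.
  set s := \sum_(k < n) _; set ri := r^-1 => ri0 s2. nra.
have E n : u n = u 0%N + series (telescope u) n by exact: eq_sum_telescope.
split; last first.
  move=> n; rewrite E (le_trans (ler_normD _ _))// lerD2l.
  rewrite /series/= big_mkord (le_trans (ler_norm_sum _ _ _))//; exact: S.
have : cvgn (series (telescope u)).
  apply: normed_cvg; apply: nondecreasing_is_cvgn.
    apply/nondecreasing_seqP => n; rewrite -[leLHS]/(\sum_(0 <= k < n) `|u k.+1 - u k|).
    by rewrite -[leRHS]/(\sum_(0 <= k < n.+1) `|u k.+1 - u k|) big_nat_recr//= lerDl.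
  exists (2^-1 * tau + r^-1) => _ [n _ <-].
  by rewrite -[leLHS]/(\sum_(0 <= k < n) `|u k.+1 - u k|) big_mkord; exact: S.
move=> /(is_cvgD (is_cvg_cst (u 0%N))).
suff -> : (fun=> u 0%N) + series (telescope u) = u by [].
by apply/funext => n; rewrite [RHS]E.
Qed.

Lemma measurable_fun_limn_einf (h : nat -> R -> \bar R) :
  (forall n, measurable_fun setT (h n)) ->
  measurable_fun setT (fun x => limn_einf (h^~ x)).
Proof.
move=> mh; rewrite [X in measurable_fun _ X](_ : _ = fun x => - limn_esup (fun n => - h n x))%E.
  apply: measurableT_comp => //; apply: measurable_fun_limn_esup => n.
  exact: measurableT_comp.
by [].
Qed.

Lemma limn_einf_ge0 (u : nat -> \bar R) : (forall n, 0 <= u n)%E -> (0 <= limn_einf u)%E.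
Proof.
move=> u0; rewrite limn_einf_lim; apply: lime_ge; first exact: is_cvg_einfs.
by apply: nearW => n; apply: le_ereal_inf_tmp => _ [m _ <-].
Qed.

Lemma fatou_ae_cvg (h : nat -> R -> \bar R) (h0 : R -> \bar R) :
  (forall n, measurable_fun setT (h n)) -> measurable_fun setT h0 ->
  (forall n x, 0 <= h n x)%E -> (forall x, 0 <= h0 x)%E ->
  {ae mu, forall x, h n x @[n --> \oo] --> h0 x} ->
  (\int[mu]_x h0 x <= limn_einf (fun n => \int[mu]_x h n x))%E.
Proof.
move=> mh mh0 hge0 h0ge0 hh0.
apply: (le_trans _ (fatou mu measurableT mh (fun n x _ => hge0 n x))).
rewrite le_eqVlt; apply/orP; left; apply/eqP; apply: ge0_ae_eq_integral => //.
- exact: measurable_fun_limn_einf.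
- move=> x _; exact: limn_einf_ge0.
- apply: filterS hh0; first exact: (ae_filter_ringOfSetsType mu).
  by move=> x hx _; rewrite (cvg_limn_einf_sup hx).1.
Qed.

End riesz_fischer.

(** * Rapidly Cauchy sequences in the weighted L^2 space *)

Section fast_cauchy.
Context {R : realType}.
Local Notation mu := (@lebesgue_measure R).

Lemma sqr_integrable_of_wenergy c (g : R -> R) a b : 0 < c ->
  measurable_fun setT g -> (wenergy c g < +oo)%E ->
  mu.-integrable `[a, b] (fun x => (g x ^+ 2)%:E).
Proof.
move=> c0 mg gfin; apply/integrableP; split.
  by apply/measurable_funTS/measurable_EFinP; exact: measurable_funX.
under eq_integral do rewrite /= ger0_norm ?sqr_ge0//.
apply: (le_lt_trans (integral_sqr_le_wenergy a b c0 mg)).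
by rewrite lte_mul_pinfty// ?lee_fin ?expR_ge0.
Qed.

(** The Riesz-Fischer argument: summable increments give a limit almost everywhere, Fatou bounds its
    energy, and dominated convergence handles the integrals over segments. *)
Lemma wenergy_fast_cauchy c (w : nat -> R -> R) : 0 < c ->
  (forall k, measurable_fun setT (w k)) ->
  (forall k, wenergy c (fun x => w k.+1 x - w k x)%R <=
     ((2 ^+ k * (2 ^ (k + 1))%:R)^-1)%:E)%E ->
  (wenergy c (w 0%N) < +oo)%E ->
  exists v : R -> R, [/\ measurable_fun setT v,
    (wenergy c v <= limn_einf (fun k => wenergy c (w k)))%E &
    forall a b, mu.-integrable `[a, b] (fun x => (v x)%:E) /\
      Rintegral mu `[a, b] (w k) @[k --> \oo] --> Rintegral mu `[a, b] v].
Proof.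
move=> c0 mw wd w0.
(* By AM-GM, the sum of [t k] bounds all increments of [w] pointwise; its integral converges thanks to the rate imposed on the energies. *)
pose t k x := 2 ^+ k * ((w k.+1 x - w k x) ^+ 2 * expR (c * x)).
have t0 k x : 0 <= t k x.
  by rewrite mulr_ge0 ?exprn_ge0// mulr_ge0 ?sqr_ge0 ?expR_ge0.
have md k : measurable_fun setT (fun x => w k.+1 x - w k x) by apply: measurable_funB.
have mt k : measurable_fun setT (fun x => (t k x)%:E).
  apply/measurable_EFinP; apply: measurable_funM => //.
  by apply/measurable_EFinP; exact: measurable_wenergy.
pose T x := (\sum_(0 <= k <oo) (t k x)%:E)%E.
have T0 x : (0 <= T x)%E by apply: nneseries_ge0 => k _ _; rewrite lee_fin.
(* The factor [2 ^+ k] of [t k] cancels the one in the rate and leaves the series of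
   [1 / 2 ^ (k + 1)], of sum 1. *)
have intT : (\int[mu]_x T x <= 1)%E.
  rewrite /T integral_nneseries//; last by move=> k x _; rewrite lee_fin.
  have -> : 1%E = (\sum_(0 <= k <oo) (1 / (2 ^ (k + 1))%:R)%:E)%E :> \bar R.
    by apply/esym/cvg_lim => //; have := @cvg_geometric_eseries_half R 1 0; rewrite expr0 divr1.
  apply: lee_nneseries => k _; first by move=> _; apply: integral_ge0 => x _; rewrite lee_fin.
  have -> : (\int[mu]_x (t k x)%:E = (2 ^+ k)%:E * wenergy c (fun x => w k.+1 x - w k x)%R)%E.
    rewrite /wenergy -ge0_integralZl_EFin//; last 2 first.
    - by move=> x _; rewrite lee_fin mulr_ge0 ?sqr_ge0 ?expR_ge0.
    - exact: measurable_wenergy.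
  have k0 : (0 : R) < 2 ^+ k by rewrite exprn_gt0.
  apply: (@le_trans _ _ ((2 ^+ k)%:E * ((2 ^+ k * (2 ^ (k + 1))%:R)^-1)%:E)%E).
    by rewrite lee_pmul2l.
  by rewrite -EFinM lee_fin invfM mulrA mulfV ?gt_eqF.
have mT : measurable_fun setT T.
  apply: (@ge0_emeasurable_sum _ _ _ _ (fun k x => (t k x)%:E) xpredT) => //.
  by move=> k x _ _; rewrite lee_fin.
have iT : mu.-integrable setT T.
  apply/integrableP; split => //; under eq_integral do rewrite gee0_abs//.
  by apply: (le_lt_trans intT); rewrite ltry.
(* The bound of [summable_increments] with [r = expR (c * x)] and [tau = fine (T x)]. *)
pose bnd x := (`|w 0%N x| + (2^-1 * fine (T x) + (expR (c * x))^-1))%R.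
have good : {ae mu, forall x, cvgn (w^~ x) /\ T x \is a fin_num /\ forall n, `|w n x| <= bnd x}.
  have := integrable_ae measurableT iT.
  apply: (@filterS _ _ (ae_filter_ringOfSetsType mu)).
  move=> x /(_ I) Tx.
  have tau n : \sum_(k < n) 2 ^+ k * ((w k.+1 x - w k x) ^+ 2 * expR (c * x)) <= fine (T x).
    rewrite -lee_fin fineK// -sumEFin -(big_mkord xpredT (fun k => (t k x)%:E)).
    by apply: nneseries_lim_ge => k _ _; rewrite lee_fin.
  by have [] := @summable_increments _ (w^~ x) _ _ (expR_gt0 (c * x)) tau.
(* An upper limit is measurable without any convergence; it is the limit wherever [w] converges. *)
pose v x := fine (limn_esup (fun k => (w k x)%:E)).
have mv : measurable_fun setT v.
  apply: measurableT_comp; first exact: fine_measurable.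
  by apply: measurable_fun_limn_esup => n; exact/measurable_EFinP.
have wv x : cvgn (w^~ x) -> w n x @[n --> \oo] --> v x.
  move=> cx; have := cx; rewrite /v (_ : limn_esup _ = (limn (w^~ x))%:E)//.
  have h : ((w n x)%:E @[n --> \oo] --> (limn (w^~ x))%:E)%E by apply: cvg_EFin => //; exact: nearW.
  by rewrite (cvg_limn_einf_sup h).2.
exists v; split => //.
  apply: fatou_ae_cvg.
  - by move=> n; exact: measurable_wenergy.
  - exact: measurable_wenergy.
  - by move=> n x; rewrite lee_fin mulr_ge0 ?sqr_ge0 ?expR_ge0.
  - by move=> x; rewrite lee_fin mulr_ge0 ?sqr_ge0 ?expR_ge0.
  - apply: filterS good; first exact: (ae_filter_ringOfSetsType mu).
    move=> x [/wv wx _]; apply: cvg_EFin; first exact: nearW.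
    by apply: cvgM; [exact: cvgM|exact: cvg_cst].
move=> a b.
have iw0 := integrable_of_sqr_integrable (mw 0%N) (sqr_integrable_of_wenergy a b c0 (mw 0%N) w0).
(* On the segment [bnd] is dominated by replacing the inverse weight with its value at [a]. *)
pose g x := (`|(w 0%N x)%:E| + (2^-1%:E * T x + (expR (- (c * a)))%:E))%E.
have ig : mu.-integrable `[a, b] g.
  apply: integrableD => //; first exact: integrable_abse.
  apply: integrableD => //; last exact: integrable_itv_cst.
  apply: integrableZl => //; exact: (integrableS measurableT).
have mw' n : measurable_fun `[a, b] (fun x => (w n x)%:E).
  by apply/measurable_funTS/measurable_EFinP.
have mv' : measurable_fun `[a, b] (fun x => (v x)%:E).
  by apply/measurable_funTS/measurable_EFinP.
have wv' : {ae mu, forall x, `[a, b]%classic x -> (w n x)%:E @[n --> \oo] --> (v x)%:E}.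
  apply: (@filterS _ _ (ae_filter_ringOfSetsType mu)) good.
  by move=> x [/wv wx _] _; apply: cvg_EFin => //; exact: nearW.
have wg : {ae mu, forall x n, `[a, b]%classic x -> (`|(w n x)%:E| <= g x)%E}.
  apply: (@filterS _ _ (ae_filter_ringOfSetsType mu)) good.
  move=> x [_ [Tx wx]] n /=; rewrite in_itv/= => /andP[ax _].
  rewrite /g -(fineK Tx) -EFinM -!EFinD lee_fin (le_trans (wx n))// /bnd !lerD2l.
  by rewrite -expRN ler_expR lerN2 ler_pM2l.
have mI : measurable (`[a, b]%classic : set (measurableTypeR R)) by [].
have [iv _ cv] := @dominated_convergence _ _ R mu _ mI _ _ _ mw' mv' wv' ig wg.
split => //; apply: fine_cvg.
by rewrite /Rintegral fineK//; exact: integrable_fin_num.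
Qed.

End fast_cauchy.

(** * Lower semicontinuity of the kinetic energy under pointwise convergence *)

Section weak_closure.
Context {R : realType}.
Local Notation mu := (@lebesgue_measure R).

Lemma limn_einf_le_cvg (u : nat -> \bar R) (r : nat -> R) (l : R) :
  (forall n, u n <= (r n)%:E)%E -> r n @[n --> \oo] --> l -> (limn_einf u <= l%:E)%E.
Proof.
move=> ur rl.
have rl' : (r n)%:E @[n --> \oo] --> l%:E by apply: cvg_EFin => //; exact: nearW.
rewrite -(cvg_lim _ rl')// limn_einf_lim; apply: lee_lim.
- exact: is_cvg_einfs.
- by apply/cvg_ex; exists l%:E.
- apply: nearW => n; apply: le_trans (ur n).
  by apply: ereal_inf_lbound; exists n => //=.
Qed.

Lemma wenergyZ c k (g : R -> R) : measurable_fun setT g ->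
  wenergy c (fun x => k * g x) = ((k ^+ 2)%:E * wenergy c g)%E.
Proof.
move=> mg; rewrite /wenergy -ge0_integralZl_EFin ?sqr_ge0//; first last.
- exact: measurable_wenergy.
- by move=> x _; rewrite lee_fin mulr_ge0 ?sqr_ge0 ?expR_ge0.
- by apply: eq_integral => x _; rewrite -EFinM mulrA -exprMn.
Qed.

(** By the parallelogram law the half-difference has energy at most [(D + e) - (D - e) = 2 * e];
    doubling the function multiplies this by 4. *)
Lemma wenergy_sub_le c (g h : R -> R) (D e : R) :
  measurable_fun setT g -> measurable_fun setT h ->
  (wenergy c g <= (D + e)%:E)%E -> (wenergy c h <= (D + e)%:E)%E ->
  ((D - e)%:E <= wenergy c (fun x => 2^-1 * g x + 2^-1 * h x)%R)%E ->
  (wenergy c (fun x => g x - h x)%R <= (8 * e)%:E)%E.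
Proof.
move=> mg mh gD hD mD.
have -> : (fun x => g x - h x) = (fun x => 2 * (2^-1 * g x + (- 2^-1) * h x)).
  by apply/funext => x; field.
rewrite wenergyZ; last exact: measurable_fun_lincomb.
have := wenergy_parallelogram c mg mh.
have m0 := wenergy_ge0 c (fun x => 2^-1 * g x + 2^-1 * h x).
have d0 := wenergy_ge0 c (fun x => 2^-1 * g x + (- 2^-1) * h x).
move: gD hD mD m0 d0 (wenergy_ge0 c g) (wenergy_ge0 c h).
set mm := wenergy c (fun x => 2^-1 * g x + 2^-1 * h x).
set dd := wenergy c (fun x => 2^-1 * g x + (- 2^-1) * h x).
move: mm dd (wenergy c g) (wenergy c h) => [m| |] [d| |] [a| |] [b| |]//=.
rewrite -EFinD -!EFinM !lee_fin => aD bD mD m0 d0 a0 b0 [E].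
by rewrite expr2; lra.
Qed.

Lemma weak_closure c (f g : nat -> R -> R) (F : R -> R) (K : nat -> R) (kappa : R) :
  0 < c -> (forall n, is_wderiv (f n) (g n)) ->
  (forall x, f n x @[n --> \oo] --> F x) ->
  (forall n, wenergy c (g n) <= (K n)%:E)%E -> K n @[n --> \oo] --> kappa ->
  exists v, is_wderiv F v /\ (wenergy c v <= kappa%:E)%E.
Proof.
move=> c0 fg fF gK Kk.
(* [A n] stands in for the convex hull of the tail [(f k, g k)], [k >= n]; only stability under midpoints is needed. *)
pose A n (p q : R -> R) := is_wderiv p q /\
  forall x e, (forall k, (n <= k)%N -> `|f k x - F x| <= e) -> `|p x - F x| <= e.
have A_decr m n p q : (m <= n)%N -> A n p q -> A m p q.
  move=> mn [pq H]; split => // x e h; apply: H => k nk; apply: h.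
  exact: leq_trans nk.
have A_mid n p q p' q' : A n p q -> A n p' q' ->
    A n (fun x => 2^-1 * p x + 2^-1 * p' x) (fun x => 2^-1 * q x + 2^-1 * q' x).
  move=> [pq H] [pq' H']; split; first exact: is_wderiv_lincomb.
  move=> x e h; have := H x e h; have := H' x e h.
  rewrite !ler_norml => /andP[? ?] /andP[? ?]; apply/andP; split; lra.
(* The classes [A n] shrink as [n] grows, so [d] is nondecreasing; its supremum [D] is at most
   [kappa] because [A n] contains the tail of the sequence. *)
pose d n := ereal_inf [set y | exists p q, A n p q /\ y = wenergy c q].
have d0 n : (0 <= d n)%E.
  by apply: le_ereal_inf_tmp => _ [p [q [_ ->]]]; exact: wenergy_ge0.
have d_le n p q : A n p q -> (d n <= wenergy c q)%E.
  by move=> H; apply: ereal_inf_lbound; exists p, q.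
have dk n : (d n <= kappa%:E)%E.
  apply/lee_addgt0Pr => e e0.
  have /cvgrPdist_le/(_ _ e0)[N _ HN] := Kk.
  have Af : A n (f (maxn n N)) (g (maxn n N)).
    by split => // x e' h; apply: h; rewrite leq_maxl.
  apply: (le_trans (d_le _ _ _ Af)); apply: (le_trans (gK _)).
  have /= := HN (maxn n N) (leq_maxr _ _).
  by rewrite -EFinD lee_fin ler_norml => /andP[? ?]; lra.
have d_ndecr m n : (m <= n)%N -> (d m <= d n)%E.
  move=> mn; apply: ereal_inf_le_tmp => _ [p [q [H ->]]].
  by exists p, q; split => //; exact: (A_decr _ _ _ _ mn H).
have [D DE] : exists D : R, ereal_sup (range d) = D%:E.
  have h0 : (0 <= ereal_sup (range d))%E.
    by apply: (le_trans (d0 0%N)); apply: ereal_sup_ubound; exists 0%N.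
  have hk : (ereal_sup (range d) <= kappa%:E)%E.
    by apply: ge_ereal_sup => _ [n _ <-].
  by case: (ereal_sup _) h0 hk => [D| |]//; exists D.
have dD n : (d n <= D%:E)%E by rewrite -DE; apply: ereal_sup_ubound; exists n.
have Dk : D <= kappa.
  by rewrite -lee_fin -DE; apply: ge_ereal_sup => _ [n _ <-].
(* The rate required by [wenergy_fast_cauchy]; the tolerance [b k / 8] used below absorbs the factor
   8 of [wenergy_sub_le]. *)
pose b k : R := (2 ^+ k * (2 ^ (k + 1))%:R)^-1.
have b0 k : 0 < b k by rewrite invr_gt0 mulr_gt0 ?exprn_gt0// ltr0n expn_gt0.
have b_decr k : b k.+1 <= b k.
  rewrite lef_pV2 ?posrE ?mulr_gt0 ?exprn_gt0 ?ltr0n ?expn_gt0//.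
  apply: ler_pM; rewrite ?exprn_ge0 ?ler0n//.
    by rewrite exprS ler_peMl ?exprn_ge0// ler1n.
  by rewrite ler_nat leq_exp2l// addSn leqnSn.
have b_half k : b k <= 2^-1 ^+ k.
  rewrite exprVn lef_pV2 ?posrE ?mulr_gt0 ?exprn_gt0 ?ltr0n ?expn_gt0//.
  by rewrite ler_peMr ?exprn_ge0// ler1n expn_gt0.
have sel k : exists z : nat * ((R -> R) * (R -> R)),
    [/\ (k <= z.1)%N, A z.1 z.2.1 z.2.2, ((D - b k / 8)%:E <= d z.1)%E &
      (wenergy c z.2.2 <= (D + b k / 8)%:E)%E].
  have bk8 : 0 < b k / 8 by rewrite divr_gt0.
  have : ((D - b k / 8)%:E < ereal_sup (range d))%E by rewrite DE lte_fin; lra.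
  move=> /ereal_sup_gt[_ [n _ <-]] Dn.
  have : (d (maxn n k) < (D + b k / 8)%:E)%E.
    by apply: (le_lt_trans (dD _)); rewrite lte_fin; lra.
  move=> /ereal_inf_lt[_ [p [q [Apq ->]]] qD].
  exists (maxn n k, (p, q)); split => //=.
  - exact: leq_maxr.
  - by apply: (le_trans (ltW Dn)); apply: d_ndecr; exact: leq_maxl.
  - exact: ltW.
have [z Hz] := choice sel.
pose p k := (z k).2.1; pose w k := (z k).2.2.
have pw k : is_wderiv (p k) (w k) by have [_ []] := Hz k.
have mw k : measurable_fun setT (w k) by have [] := pw k.
have wd k : (wenergy c (fun x => w k.+1 x - w k x)%R <= (b k)%:E)%E.
  have -> : b k = 8 * (b k / 8) by field.
  have [_ A0 D0 w0] := Hz k; have [_ A1 D1 w1] := Hz k.+1.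
  have bb := b_decr k.
  apply: (@wenergy_sub_le c _ _ D) => //.
    by apply: (le_trans w1); rewrite lee_fin; lra.
  (* Both pairs lie in the class of the smaller index, so their midpoint does too and its energy is
     at least [d] at that index. *)
  have [le01|le10] := leqP (z k).1 (z k.+1).1.
    by apply: (le_trans D0); apply: d_le (A_mid _ _ _ _ _ (A_decr _ _ _ _ le01 A1) A0).
  apply: (@le_trans _ _ (D - b k.+1 / 8)%:E); first by rewrite lee_fin; lra.
  by apply: (le_trans D1); apply: d_le (A_mid _ _ _ _ _ A1 (A_decr _ _ _ _ (ltnW le10) A0)).
have w0 : (wenergy c (w 0%N) < +oo)%E.
  by have [_ _ _ h] := Hz 0%N; apply: (le_lt_trans h); rewrite ltry.
have [v [mv vle vcv]] := wenergy_fast_cauchy c0 mw wd w0.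
have vD : (wenergy c v <= D%:E)%E.
  apply: (le_trans vle); apply: (@limn_einf_le_cvg _ (fun k => D + 8^-1 * 2^-1 ^+ k)).
    move=> k; have [_ _ _ h] := Hz k; apply: (le_trans h).
    by rewrite lee_fin lerD2l mulrC ler_pM2l.
  rewrite -[X in _ --> X]addr0; apply: cvgD; first exact: cvg_cst.
  rewrite -(mulr0 8^-1); apply: cvgM; first exact: cvg_cst.
  by apply: cvg_expr; rewrite ger0_norm// invf_lt1// ltr1n.
(* [p k] is as close to [F] as the tail starting at [(z k).1 >= k]. *)
have pF x : p k x @[k --> \oo] --> F x.
  apply/cvgrPdist_le => e e0.
  have /cvgrPdist_le/(_ _ e0)[N _ HN] := fF x.
  exists N => // k /= Nk; rewrite distrC.
  have [zk [_ H] _ _] := Hz k; apply: H => j zj; rewrite distrC; apply: HN => /=.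
  by apply: leq_trans zj; apply: leq_trans zk.
exists v; split; last by apply: (le_trans vD); rewrite lee_fin.
split => // x y xy; have [iv cv] := vcv x y; split; [|split => //].
  exact: (sqr_integrable_of_wenergy x y c0 mv (le_lt_trans vD (ltry D))).
have c1 : p k y - p k x @[k --> \oo] --> F y - F x by apply: cvgB.
apply: (cvg_unique _ c1) => //.
suff -> : (fun k => p k y - p k x) = (fun k => Rintegral mu `[x, y] (w k)) by [].
by apply/funext => k; have [_ /(_ _ _ xy)[_ [_ ->]]] := pw k.
Qed.

End weak_closure.

(** * Integrability of the weight on left half-lines, and integrals of differences *)

Section integrals.
Context {R : realType}.
Local Notation mu := (@lebesgue_measure R).

(** Reflection moves the integral to a right half-line, where the primitive
    [- (c^-1 * expR (- c * x))] tends to 0 at infinity. *)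
Lemma integrable_expR_Ny (c L : R) : 0 < c ->
  mu.-integrable `]-oo, L] (fun x => (expR (c * x))%:E).
Proof.
move=> c0.
have cexp (k : R) : continuous (fun x : R => expR (k * x)).
  by move=> x; apply: continuous_comp; [exact: mulrl_continuous|exact: continuous_expR].
apply/integrableP; split.
  by apply/measurable_funTS/measurable_EFinP; exact: measurable_expR_scale.
under eq_integral do rewrite /= ger0_norm ?expR_ge0//.
have -> : L = - (- L) by rewrite opprK.
rewrite ge0_integration_by_substitutionNy; last 2 first.
- exact/continuous_subspaceT/cexp.
- by move=> x _; exact: expR_ge0.
have dF (x : R) : is_derive x (1 : R) (fun x : R => - (c^-1 * expR (- c * x))) (expR (- c * x)).
  have hd : is_derive x (1 : R) (fun x : R => - c * x) (- c).
    by apply: is_derive_eq; rewrite ?scaler0 ?add0r ?scaler1 ?addr0 /GRing.scale/=.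
  apply: is_derive_eq; rewrite /GRing.scale/=; field; exact: lt0r_neq0.
rewrite (@ge0_continuous_FTC2y _ _ (fun x => - (c^-1 * expR (- c * x))) _ 0).
- by rewrite ltry.
- by move=> x _ /=; exact: expR_ge0.
- apply: continuous_subspaceT => x /=.
  rewrite (_ : _ \o _ = fun x => expR (- c * x)); first exact: cexp.
  by apply/funext => y /=; rewrite mulrN mulNr.
- rewrite -oppr0 -(mulr0 c^-1); apply: cvgN; apply: cvgM; first exact: cvg_cst.
  rewrite (_ : (fun x => expR (- c * x)) = (fun x => expR (- x)) \o (fun x => c * x)); last first.
    by apply/funext => y /=; rewrite mulNr.
  apply: (cvg_comp _ _ _ (@cvgr_expR R)).
  exact: gt0_cvgMry.
- by move=> x _; have [] := dF x.
- apply: cvg_at_right_filter; apply: cvgN; apply: cvgM; first exact: cvg_cst.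
  exact: cexp.
- move=> x _; rewrite derive1E; have [_ ->] := dF x.
  by rewrite /= mulrN mulNr.
Qed.

(** The case to settle is an infinite integral of [p]: the negative part of [p - b] is at most [b],
    hence of finite integral, while [p <= (p - b)^+ + b] makes the positive part infinite. *)
Lemma integral_sub_integrable (p b : R -> R) :
  measurable_fun setT p -> (forall x, 0 <= p x) -> (forall x, 0 <= b x) ->
  mu.-integrable setT (EFin \o b) ->
  (\int[mu]_x (p x - b x)%:E = \int[mu]_x (p x)%:E - \int[mu]_x (b x)%:E)%E.
Proof.
move=> mp p0 b0 ib.
have mb : measurable_fun setT b by apply/measurable_EFinP; exact: measurable_int ib.
have bfin : (\int[mu]_x (b x)%:E)%E \is a fin_num by exact: integrable_fin_num.
have [pfin|] := ltP (\int[mu]_x (p x)%:E)%E +oo%E.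
  have ip : mu.-integrable setT (EFin \o p).
    apply/integrableP; split; first exact/measurable_EFinP.
    by under eq_integral do rewrite /= ger0_norm//.
  exact: (integralB measurableT ip ib).
rewrite leye_eq => /eqP pE; rewrite pE addye; last first.
  by rewrite eqe_oppLR /=; case: (\int[mu]_x _)%E bfin.
rewrite integralE.
pose f x := (p x - b x)%:E.
have mf : measurable_fun setT f by apply/measurable_EFinP; exact: measurable_funB.
have neg : (\int[mu]_x (f^\- x) <= \int[mu]_x (b x)%:E)%E.
  apply: ge0_le_integral => //.
  - exact: measurable_funeneg.
  - exact/measurable_EFinP.
  - move=> x _; rewrite funenegE /f -EFinN -EFin_max lee_fin ge_max b0 andbT.
    by have := p0 x; lra.
have pos : (\int[mu]_x (f^\+ x) = +oo)%E.
  have : (\int[mu]_x (p x)%:E <= \int[mu]_x (f^\+ x) + \int[mu]_x (b x)%:E)%E.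
    rewrite -ge0_integralD//; last 3 first.
    - exact: measurable_funepos.
    - by move=> x _; rewrite lee_fin.
    - exact/measurable_EFinP.
    apply: ge0_le_integral => //.
    - by move=> x _; rewrite lee_fin.
    - exact/measurable_EFinP.
    - apply: emeasurable_funD; [exact: measurable_funepos|exact/measurable_EFinP].
    - move=> x _; rewrite funeposE /f -EFin_max -EFinD lee_fin -lerBlDr.
      by rewrite le_max lexx.
  by rewrite pE leye_eq; case: (\int[mu]_x f^\+ x)%E bfin => [r| |]//; case: (\int[mu]_x _)%E.
rewrite -/f pos addye//.
have : (0 <= \int[mu]_x f^\- x)%E by apply: integral_ge0 => x _; exact: funeneg_ge0.
by move: neg; case: (\int[mu]_x f^\- x)%E => //; case: (\int[mu]_x _)%E bfin.
Qed.

End integrals.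

(** * Coordinatewise convergence and the Euclidean norm *)

Section row_vectors.
Context {R : realType} {N : nat}.

Lemma cvg_sumr (I : Type) (r : seq I) (f : I -> nat -> R) (l : I -> R) :
  (forall i, f i n @[n --> \oo] --> l i) ->
  \sum_(i <- r) f i n @[n --> \oo] --> \sum_(i <- r) l i.
Proof.
move=> fl; elim: r => [|i r IH].
  by rewrite big_nil; under eq_fun do rewrite big_nil; exact: cvg_cst.
by rewrite big_cons; under eq_fun do rewrite big_cons; exact: cvgD.
Qed.

Lemma cvg_row (T : Type) (F : set_system T) (FF : Filter F) (u : T -> 'rV[R]_N) (l : 'rV[R]_N) :
  (forall i, u n ord0 i @[n --> F] --> l ord0 i) -> u @ F --> l.
Proof.
move=> ul; apply/cvg_ballP => e e0.
have : \forall n \near F, forall i, ball (l ord0 i) e (u n ord0 i).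
  by apply: filter_forall => i; have /cvg_ballP := ul i; exact.
by apply: filterS => n H; split=> // i j; rewrite (ord1 i); exact: H.
Qed.

Lemma cvg_coord (T : Type) (F : set_system T) (FF : Filter F) (u : T -> 'rV[R]_N) (l : 'rV[R]_N) i :
  u @ F --> l -> u n ord0 i @[n --> F] --> l ord0 i.
Proof.
move=> /cvg_ballP ul; apply/cvg_ballP => e e0.
by have := ul e e0; apply: filterS => n [_ /(_ ord0 i)].
Qed.

Lemma eucl_norm_le (v : 'rV[R]_N) (r : R) : 0 <= r ->
  (eucl_norm v <= r) = (\sum_(i < N) v ord0 i ^+ 2 <= r ^+ 2).
Proof.
move=> r0; rewrite /eucl_norm -{1}[r]ger0_norm// -sqrtr_sqr ler_sqrt ?sqr_ge0//.
Qed.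

Lemma coord_le_eucl_norm (v : 'rV[R]_N) i : `|v ord0 i| <= eucl_norm v.
Proof.
rewrite -sqrtr_sqr ler_wsqrtr// (bigD1 i)//= lerDl.
by apply: sumr_ge0 => j _; exact: sqr_ge0.
Qed.

Lemma eucl_norm_cvg_le (u : nat -> 'rV[R]_N) (l a : 'rV[R]_N) (r : R) : 0 <= r ->
  u @ \oo --> l -> (forall n, eucl_norm (u n - a) <= r) -> eucl_norm (l - a) <= r.
Proof.
move=> r0 ul ua; rewrite eucl_norm_le//.
have c : \sum_(i < N) (u n - a) ord0 i ^+ 2 @[n --> \oo] --> \sum_(i < N) (l - a) ord0 i ^+ 2.
  apply: cvg_sumr => i.
  have ci : (u n - a) ord0 i @[n --> \oo] --> (l - a) ord0 i.
    by apply: cvg_coord; apply: cvgB => //; exact: cvg_cst.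
  by rewrite expr2; under eq_fun do rewrite expr2; exact: cvgM.
by apply: (cvgr_to_le c); apply: nearW => n; rewrite -eucl_norm_le.
Qed.

Lemma H1loc_continuous (U : R -> 'rV[R]_N) : H1loc U -> continuous U.
Proof.
move=> HU x; apply: cvg_row => i; have [g fg] := HU i.
exact: (is_wderiv_continuous fg).
Qed.

Lemma measurable_comp_H1loc (W : 'rV[R]_N -> R) (U : R -> 'rV[R]_N) :
  continuous W -> H1loc U -> measurable_fun setT (W \o U).
Proof.
move=> cW HU; apply: continuous_measurable_fun => x.
by apply: continuous_comp; [exact: H1loc_continuous|exact: cW].
Qed.

End row_vectors.

(** * Nonemptiness of the admissible class *)

Section admissible_class.
Context {R : realType} {N : nat}.
Local Notation mu := (@lebesgue_measure R).

Lemma is_wderiv_cst (k : R) : is_wderiv (fun=> k) (fun=> 0).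
Proof.
split => // a b ab; rewrite expr0n/= subrr; split; [|split].
- exact: integrable_itv_cst.
- exact: integrable_itv_cst.
- by rewrite Rintegral_cst// mul0r.
Qed.

(** The piecewise linear ramp from 0 at [- L] to [2 * L] at [L], written as an integral so that its
    weak derivative is read off. *)
Definition transition_length (L x : R) : R :=
  Rintegral mu `]-oo, x] \1_(`]-L, L]%classic : set R).

Lemma is_wderiv_transition (L : R) :
  is_wderiv (transition_length L) \1_(`]-L, L]%classic : set R).
Proof.
have mI : measurable_fun setT (\1_(`]-L, L]%classic : set R) : R -> R) by exact: measurable_indic.
have le1 x : (\1_(`]-L, L]%classic : set R) x : R) ^+ 2 <= 1.
  by rewrite indicE; case: (_ \in _); rewrite ?expr1n ?expr0n//=.
have iT : mu.-integrable setT (EFin \o (\1_(`]-L, L]%classic : set R) : R -> R)).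
  apply/integrableP; split; first exact/measurable_EFinP.
  under eq_integral do rewrite /= ger0_norm ?ler0n//.
  rewrite integral_indic// setIT /= lebesgue_measure_itv/=.
  by case: ifP => _; rewrite ?ltry// -EFinB ltry.
split => // a b ab.
have i2 : mu.-integrable `[a, b] (fun x => ((\1_(`]-L, L]%classic : set R) x : R) ^+ 2)%:E).
  apply: (le_integrable _ _ _ (integrable_itv_cst 1 a b)) => //.
    by apply/measurable_funTS/measurable_EFinP; exact: measurable_funX.
  by move=> x _; rewrite /= lee_fin !ger0_norm ?sqr_ge0.
split => //; split; first exact: integrable_of_sqr_integrable.
rewrite /transition_length -Rintegral_itv_obnd_cbnd; last first.
  exact: (integrableS measurableT).
rewrite (@Rintegral_itvB _ _ -oo%O (BRight b) a)//.
exact: (integrableS measurableT).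
Qed.

Lemma transition_left (L x : R) : x <= - L -> transition_length L x = 0.
Proof.
move=> xL; rewrite /transition_length /Rintegral integral_indic//.
rewrite (_ : _ `&` _ = set0) ?measure0//.
apply/seteqP; split => // y [/=]; rewrite !in_itv/= => /andP[? _] ?; lra.
Qed.

Lemma transition_right (L x : R) : 0 < L -> L <= x -> transition_length L x = 2 * L.
Proof.
move=> L0 xL; rewrite /transition_length /Rintegral integral_indic//.
rewrite (_ : _ `&` _ = `]- L, L]%classic); last first.
  apply/seteqP; split => y /=; first by move=> [].
  by rewrite !in_itv/= => /andP[? ?]; split; [apply/andP|apply: le_trans xL].
rewrite /= lebesgue_measure_itv/= lte_fin ifT; last lra.
by rewrite /= opprK mulrDl mul1r.
Qed.

(** The witness equals [am] before [- L], [ap] after [L], and is affine in between. *)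
Lemma XL_nonempty (ap am : 'rV[R]_N) (r0 L : R) : 0 <= r0 -> 0 < L ->
  exists U, XL ap am r0 L U.
Proof.
move=> r00 L0.
have e0 : eucl_norm (0 : 'rV[R]_N) <= r0.
  by rewrite eucl_norm_le// big1 ?sqr_ge0// => i _; rewrite mxE expr0n.
exists (fun x => am + (transition_length L x / (2 * L)) *: (ap - am)); split; [|split].
- move=> i; exists (fun x => am ord0 i * 0 + ((ap - am) ord0 i / (2 * L)) * \1_(`]-L, L]%classic : set R) x).
  rewrite (_ : (fun _ => _) = fun x => am ord0 i * 1 + ((ap - am) ord0 i / (2 * L)) * transition_length L x).
    by apply: is_wderiv_lincomb; [exact: is_wderiv_cst|exact: is_wderiv_transition].
  by apply/funext => x; rewrite !mxE; field; rewrite gt_eqF.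
- move=> x xL; rewrite transition_right// divff ?mulf_neq0 ?gt_eqF//.
  by rewrite scale1r addrCA subrr addr0 subrr.
- by move=> x xL; rewrite transition_left// mul0r scale0r addr0 subrr.
Qed.

End admissible_class.

(** * Compactness of the admissible class under bounded energy *)

Section compactness.
Context {R : realType} {N : nat}.

Lemma is_wderiv_osc_near c (f g : R -> R) M a x y t : 0 < c -> 0 < t ->
  a <= x -> a <= y -> is_wderiv f g -> (wenergy c g <= M%:E)%E ->
  `|f y - f x| <= t / 2 * (expR (- (c * a)) * M) + `|y - x| / (2 * t).
Proof.
move=> c0 t0; wlog xy : x y / x <= y => [H ax ay fg gM|ax ay fg gM].
  have [xy|/ltW yx] := leP x y; first exact: H.
  by rewrite distrC [`|y - x|]distrC; apply: H.
apply: (le_trans (is_wderiv_osc c0 t0 xy fg gM)).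
rewrite (ger0_norm (_ : 0 <= y - x)) ?subr_ge0// lerD2r ler_pM2l ?divr_gt0//.
apply: ler_wpM2r; last by rewrite ler_expR lerN2 ler_pM2l.
by rewrite -lee_fin; apply: le_trans gM; exact: wenergy_ge0.
Qed.

Lemma half_margin (e C : R) : 0 < e -> 0 <= C -> e / (C + 1) / 2 * C <= e / 2.
Proof.
move=> e0 C0; have C1 : 0 < C + 1 by rewrite ltr_wpDl.
have -> : e / (C + 1) / 2 * C = e / 2 * (C / (C + 1)) by field; rewrite lt0r_neq0.
by rewrite ler_piMr ?divr_ge0 ?ltW// ltr_pdivrMr// mul1r ltrDl.
Qed.

Lemma half_quotient (e d t : R) : 0 < t -> d < e * t -> d / (2 * t) <= e / 2.
Proof.
move=> t0 dt; have -> : d / (2 * t) = d / t / 2 by field; rewrite lt0r_neq0.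
by rewrite ler_pM2r ?invr_gt0// ler_pdivrMr// ltW.
Qed.

(** The coordinate energies converge along the same [phi] as the functions, so that the kinetic part
    can later be subtracted from the total energy before passing to the limit. *)
Lemma XL_compact (c : R) (ap am : 'rV[R]_N) (r0 L M : R) (U : nat -> R -> 'rV[R]_N) :
  0 < c -> 0 <= r0 -> (forall n, XL ap am r0 L (U n)) ->
  (forall n i, wenergy c (wderiv (fun x => U n x ord0 i)) <= M%:E)%E ->
  exists (phi : nat -> nat) (V : R -> 'rV[R]_N) (kappa : 'I_N -> R),
    [/\ forall k, (k <= phi k)%N, XL ap am r0 L V,
      forall x, U (phi n) x @[n --> \oo] --> V x,
      forall i, fine (wenergy c (wderiv (fun x => U (phi n) x ord0 i)))
        @[n --> \oo] --> kappa i &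
      forall i, (wenergy c (wderiv (fun x => V x ord0 i)) <= (kappa i)%:E)%E].
Proof.
move=> c0 r00 XU UM.
have wU n i : is_wderiv (fun x => U n x ord0 i) (wderiv (fun x => U n x ord0 i)).
  by apply: wderivP; have [+ _] := XU n; exact.
pose q n i := fine (wenergy c (wderiv (fun x => U n x ord0 i))).
have qE n i : wenergy c (wderiv (fun x => U n x ord0 i)) = (q n i)%:E.
  by rewrite /q fineK// ge0_fin_numE ?wenergy_ge0// (le_lt_trans (UM n i))// ltry.
have [G [PG sG Glim]] := @exists_limit_filter R.
(* Pointwise bound: compare [x] with the anchor [L], where [U n] is within [r0] of [ap], using the
   oscillation estimate with [t = 1]. *)
have HVex (z : R * 'I_N) : exists l : R, U n z.1 ord0 z.2 @[n --> G] --> l.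
  move: z => [x i] /=.
  pose a := Num.min x L.
  apply: (Glim _ (`|ap ord0 i| + r0 + (1 / 2 * (expR (- (c * a)) * M) + `|x - L| / (2 * 1)))) => n.
  have := @is_wderiv_osc_near c _ _ M a L x 1 c0 ltr01 _ _ (wU n i) (UM n i).
  rewrite /a ge_min lexx orbT ge_min lexx => /(_ isT isT) h.
  have [_ [/(_ L (lexx _)) hL _]] := XU n.
  have := le_trans (coord_le_eucl_norm _ i) hL; rewrite !mxE => h'.
  rewrite [U n x ord0 i](_ : _ = ap ord0 i + (U n L ord0 i - ap ord0 i) + (U n x ord0 i - U n L ord0 i)); last ring.
  by rewrite (le_trans (ler_normD _ _))// lerD// (le_trans (ler_normD _ _))// lerD2l.
have [Vf HV] := choice HVex.
have Hkex i : exists l : R, q n i @[n --> G] --> l.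
  apply: (Glim _ M) => n; rewrite ger0_norm -lee_fin -qE; [exact: UM|exact: wenergy_ge0].
have [kappa Hk] := choice Hkex.
(* One countable index set gathers the values at rational points and the energies, so a single [phi]
   serves both. *)
pose u (t : rat * 'I_N + 'I_N) n :=
  match t with inl z => U n (ratr z.1) ord0 z.2 | inr i => q n i end.
pose l (t : rat * 'I_N + 'I_N) :=
  match t with inl z => Vf (ratr z.1, z.2) | inr i => kappa i end.
have ul t : u t @ G --> l t.
  by case: t => [[z i]|i]; [exact: (HV (ratr z, i))|exact: Hk].
have [phi [phik phil]] := countable_selection PG sG ul.
have Vx i x : U (phi n) x ord0 i @[n --> \oo] --> Vf (x, i).
  apply: (@equicontinuous_cvg_of_rat R (fun n x => U n x ord0 i) (fun x => Vf (x, i)) G phi PG).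
  - move=> y e e0.
    (* [y - 1] is a lower bound for the points within distance 1 of [y]. With [t = e / (C + 1)],
       whose denominator stays positive even if [C = 0], each of the two terms of the oscillation
       bound is at most [e / 2]. *)
    pose C := expR (- (c * (y - 1))) * M.
    have C0 : 0 <= C.
      rewrite mulr_ge0 ?expR_ge0// -lee_fin; apply: le_trans (UM 0%N i); exact: wenergy_ge0.
    pose t := e / (C + 1).
    have t0 : 0 < t by rewrite divr_gt0// ltr_wpDl.
    exists (Num.min 1 (e * t)); first by rewrite lt_min ltr01 mulr_gt0.
    move=> n z; rewrite lt_min => /andP[z1 zt].
    have yz : y - 1 <= z by move: z1; rewrite ltr_norml => /andP[? _]; lra.
    have yy : y - 1 <= y by lra.
    apply: (le_trans (is_wderiv_osc_near c0 t0 yy yz (wU n i) (UM n i))).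
    have h1 : t / 2 * C <= e / 2.
      exact: half_margin.
    have h2 : `|z - y| / (2 * t) <= e / 2.
      exact: half_quotient.
    by rewrite [leRHS](splitr e) lerD.
  - by move=> y; exact: (HV (y, i)).
  - by move=> r; exact: (phil (inl (r, i))).
pose V x : 'rV[R]_N := \row_i Vf (x, i).
have UV x : U (phi n) x @[n --> \oo] --> V x.
  by apply: cvg_row => i; rewrite mxE; exact: Vx.
have closure i : exists v, is_wderiv (fun x => V x ord0 i) v /\
    (wenergy c v <= (kappa i)%:E)%E.
  apply: (@weak_closure _ c (fun n x => U (phi n) x ord0 i)
    (fun n => wderiv (fun x => U (phi n) x ord0 i)) _ (fun n => q (phi n) i)) => //.
  - by move=> x; rewrite mxE; exact: Vx.
  - by move=> n; rewrite qE.
  - exact: (phil (inr i)).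
exists phi, V, kappa; split => //.
- split; first by move=> i; have [v [Vv _]] := closure i; exists v.
  split=> x xL; apply: (eucl_norm_cvg_le r00 (UV x)) => n.
    by have [_ [/(_ x xL)]] := XU (phi n).
  by have [_ [_ /(_ x xL)]] := XU (phi n).
- by move=> i; exact: (phil (inr i)).
- by move=> i; have [v [Vv vk]] := closure i; rewrite (wenergy_wderiv c Vv).
Qed.

End compactness.

(** * Splitting of the energy into nonnegative terms minus a fixed constant *)

Section energy_decomposition.
Context {R : realType} {N : nat}.
Local Notation mu := (@lebesgue_measure R).
Context (W : 'rV[R]_N -> R) (ap am : 'rV[R]_N) (r0 L c : R).
Context (cW : continuous W) (Wam : W am < 0) (minW : global_min W am)
  (Wap : forall u, eucl_norm (u - ap) <= r0 -> 0 <= W u) (c0 : 0 < c).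

(* An integrable bound, uniform over the admissible class, of the negative part of [W (U x) * expR (c * x)]. *)
Definition neg_bound (x : R) : R := ((fun x => - W am * expR (c * x)) \_ `]-oo, L]) x.

Definition shifted_potential (U : R -> 'rV[R]_N) (x : R) : R :=
  W (U x) * expR (c * x) + neg_bound x.

Lemma integrable_neg_bound : mu.-integrable setT (EFin \o neg_bound).
Proof.
rewrite (_ : EFin \o neg_bound = (EFin \o (fun x => - W am * expR (c * x))) \_ `]-oo, L]); last first.
  by rewrite restrict_EFin.
rewrite -integrable_mkcond//.
exact: (integrableZl _ (- W am) (integrable_expR_Ny L c0)).
Qed.

Lemma neg_bound_ge0 x : 0 <= neg_bound x.
Proof.
rewrite /neg_bound patchE; case: ifP => // _.
by rewrite mulr_ge0 ?expR_ge0// oppr_ge0 ltW.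
Qed.

Lemma measurable_neg_bound : measurable_fun setT neg_bound.
Proof. by apply/measurable_EFinP; exact: measurable_int integrable_neg_bound. Qed.

(** Up to [L] the shift compensates the minimal value [W am]; beyond [L] the constraint keeps [U x]
    in the ball around [ap] where [W] is nonnegative. *)
Lemma shifted_potential_ge0 U x : XL ap am r0 L U -> 0 <= shifted_potential U x.
Proof.
move=> [_ [UL _]]; rewrite /shifted_potential /neg_bound patchE.
case: ifPn => [_|].
  rewrite -mulrDl mulr_ge0 ?expR_ge0// subr_ge0; exact: minW.
rewrite notin_setE /= in_itv/= => /negP; rewrite -ltNge => Lx.
by rewrite addr0 mulr_ge0 ?expR_ge0// Wap// UL// ltW.
Qed.

Lemma measurable_shifted_potential U : H1loc U -> measurable_fun setT (shifted_potential U).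
Proof.
move=> HU; apply: measurable_funD; last exact: measurable_neg_bound.
apply: measurable_funM; last exact: measurable_expR_scale.
exact: measurable_comp_H1loc.
Qed.

(** The subtracted integral is finite and does not depend on [U], so minimizing [Ec] reduces to
    minimizing a sum of nonnegative terms, to which Fatou's lemma applies. *)
Lemma Ec_decomp U : XL ap am r0 L U ->
  Ec W c U = (\sum_(i < N) (2^-1)%:E * wenergy c (wderiv (fun x => U x ord0 i)) +
    \int[mu]_x (shifted_potential U x)%:E - \int[mu]_x (neg_bound x)%:E)%E.
Proof.
move=> XU; have [HU _] := XU.
have mg i : measurable_fun setT (wderiv (fun x => U x ord0 i)).
  by have [] := wderivP (HU i).
have mk : measurable_fun setT (fun x => 2^-1 * grad_sq U x * expR (c * x)).
  apply: measurable_funM; last exact: measurable_expR_scale.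
  by apply: measurable_funM => //; apply: measurable_sum => i; exact: measurable_funX.
have k0 x : 0 <= 2^-1 * grad_sq U x * expR (c * x).
  rewrite mulr_ge0 ?expR_ge0// mulr_ge0//.
  by apply: sumr_ge0 => i _; exact: sqr_ge0.
have mh := measurable_shifted_potential HU.
have h0 x := shifted_potential_ge0 x XU.
have -> : Ec W c U = (\int[mu]_x ((2^-1 * grad_sq U x * expR (c * x) + shifted_potential U x) - neg_bound x)%:E)%E.
  by apply: eq_integral => x _; congr (_%:E); rewrite /shifted_potential; ring.
rewrite integral_sub_integrable; last 4 first.
- exact: measurable_funD.
- by move=> x; rewrite addr_ge0.
- exact: neg_bound_ge0.
- exact: integrable_neg_bound.
congr (_ - _)%E; under eq_integral do rewrite EFinD.
rewrite ge0_integralD//; last 4 first.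
- by move=> x _; rewrite lee_fin.
- exact/measurable_EFinP.
- by move=> x _; rewrite lee_fin.
- exact/measurable_EFinP.
congr (_ + _)%E.
transitivity (\int[mu]_x (\sum_(i < N)
    ((2^-1)%:E * (wderiv (fun y => U y ord0 i) x ^+ 2 * expR (c * x))%:E)))%E.
  apply: eq_integral => x _; rewrite /grad_sq mulr_sumr mulr_suml -sumEFin.
  by apply: eq_bigr => i _; rewrite -EFinM -mulrA.
rewrite ge0_integral_sum//; last 2 first.
- by move=> i; apply: emeasurable_funM => //; exact: measurable_wenergy.
- by move=> i x _; rewrite -EFinM lee_fin mulr_ge0// mulr_ge0 ?sqr_ge0 ?expR_ge0.
apply: eq_bigr => i _; rewrite ge0_integralZl_EFin//.
- by move=> x _; rewrite lee_fin mulr_ge0 ?sqr_ge0 ?expR_ge0.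
- exact: measurable_wenergy.
Qed.

End energy_decomposition.

(** The direct method is run on [J], which takes values in [[0, +oo]], so its infimum is either a
    real number or [+oo]. *)
Lemma exists_shifted_minimizer (R : realType) (N : nat) (W : 'rV[R]_N -> R)
    (ap am : 'rV[R]_N) (r0 L c : R) :
  continuous W -> W am < 0 -> global_min W am -> 0 < r0 ->
  (forall u, eucl_norm (u - ap) <= r0 -> 0 <= W u) -> 0 < L -> 0 < c ->
  let J (U : R -> 'rV[R]_N) := (\sum_(i < N) (2^-1)%:E * wenergy c (wderiv (fun x => U x ord0 i)) +
    \int[@lebesgue_measure R]_x (shifted_potential W am L c U x)%:E)%E in
  exists2 V, XL ap am r0 L V & forall U, XL ap am r0 L U -> (J V <= J U)%E.
Proof.
move=> cW Wam minW r00 Wap L0 c0 J.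
have Q0 (U : R -> 'rV[R]_N) i : (0 <= (2^-1)%:E * wenergy c (wderiv (fun x => U x ord0 i)) :> \bar R)%E.
  by rewrite mule_ge0 ?wenergy_ge0// lee_fin.
have H0 U : XL ap am r0 L U ->
    (0 <= \int[@lebesgue_measure R]_x (shifted_potential W am L c U x)%:E)%E.
  by move=> XU; apply: integral_ge0 => x _; rewrite lee_fin (shifted_potential_ge0 c minW Wap x XU).
have J0 U : XL ap am r0 L U -> (0 <= J U)%E.
  by move=> XU; rewrite adde_ge0 ?H0// sume_ge0.
suff [V XV JV] : exists2 V, XL ap am r0 L V &
    (J V <= ereal_inf [set J U | U in XL ap am r0 L])%E.
  by exists V => // U XU; apply: (le_trans JV); apply: ereal_inf_lbound; exists U.
have : (0 <= ereal_inf [set J U | U in XL ap am r0 L])%E.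
  by apply: le_ereal_inf_tmp => _ [U XU <-]; exact: J0.
case E : ereal_inf => [j| |]// j0; last first.
  (* If the infimum is [+oo], any admissible map is a minimizer. *)
  by have [V XV] := XL_nonempty ap am (ltW r00) L0; exists V => //; exact: leey.
have sel n : exists U : R -> 'rV[R]_N, XL ap am r0 L U /\ (J U <= (j + n.+1%:R^-1)%:E)%E.
  have : (ereal_inf [set J U | U in XL ap am r0 L] < (j + n.+1%:R^-1)%:E)%E.
    by rewrite E lte_fin ltrDl invr_gt0.
  by move=> /ereal_inf_lt[_ [U XU <-]] /ltW; exists U.
have [U HU] := choice sel.
have XU n : XL ap am r0 L (U n) := (HU n).1.
have UM n i : (wenergy c (wderiv (fun x => U n x ord0 i)) <= (2 * (j + 1))%:E)%E.
  have : ((2^-1)%:E * wenergy c (wderiv (fun x => U n x ord0 i)) <= (j + 1)%:E)%E.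
    apply: (@le_trans _ _ (J (U n))).
      rewrite /J (bigD1 i)//= -addeA leeDl// adde_ge0 ?H0//.
      by apply: sume_ge0 => k _.
    apply: (le_trans (HU n).2); rewrite lee_fin lerD2l invf_le1 ?ler1n//.
  case: (wenergy _ _) (wenergy_ge0 c (wderiv (fun x => U n x ord0 i))) => [q| |]//.
    by rewrite -EFinM !lee_fin => _ h; lra.
  by rewrite gt0_muley ?lte_fin ?invr_gt0.
have [phi [V [kappa [phik XV UV qk Vk]]]] := XL_compact c0 (ltW r00) XU UM.
exists V => //.
pose q n i := fine (wenergy c (wderiv (fun x => U n x ord0 i))).
have qE n i : wenergy c (wderiv (fun x => U n x ord0 i)) = (q n i)%:E.
  by rewrite /q fineK// ge0_fin_numE ?wenergy_ge0// (le_lt_trans (UM n i))// ltry.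
(* Removing the finite kinetic part from the bound on [J] leaves a real bound on the potential part,
   with a limit as [n] grows. *)
have hle n : (\int[@lebesgue_measure R]_x (shifted_potential W am L c (U (phi n)) x)%:E <=
    (j + (phi n).+1%:R^-1 - \sum_(i < N) 2^-1 * q (phi n) i)%:E)%E.
  have := (HU (phi n)).2; rewrite /J.
  under eq_bigr do rewrite qE -EFinM.
  rewrite sumEFin; case: (\int[_]_x _)%E (H0 _ (XU (phi n))) => [h| |]//.
  by rewrite -EFinD !lee_fin => _; rewrite lerBrDl.
have phi0 : (phi n).+1%:R^-1 @[n --> \oo] --> (0 : R).
  apply: (@squeeze_cvgr _ _ _ _ (fun=> 0) (fun n => n.+1%:R^-1)).
  - apply: nearW => n; rewrite invr_ge0 ler0n/= lef_pV2 ?posrE//.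
    by rewrite ler_nat ltnS.
  - exact: cvg_cst.
  - exact: cvg_harmonic.
have rl : j + (phi n).+1%:R^-1 - \sum_(i < N) 2^-1 * q (phi n) i @[n --> \oo] -->
    j - \sum_(i < N) 2^-1 * kappa i.
  apply: cvgB; last first.
    by apply: cvg_sumr => i; apply: cvgM; [exact: cvg_cst|exact: qk].
  by rewrite -[X in _ --> X]addr0; apply: cvgD => //; exact: cvg_cst.
have fat : (\int[@lebesgue_measure R]_x (shifted_potential W am L c V x)%:E <=
    (j - \sum_(i < N) 2^-1 * kappa i)%:E)%E.
  apply: le_trans (limn_einf_le_cvg hle rl); apply: fatou_ae_cvg.
  - move=> n; apply/measurable_EFinP.
    by apply: measurable_shifted_potential => //; case: (XU (phi n)).
  - by apply/measurable_EFinP; apply: measurable_shifted_potential => //; case: XV.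
  - by move=> n x; rewrite lee_fin; exact: (shifted_potential_ge0 c minW Wap).
  - by move=> x; rewrite lee_fin; exact: (shifted_potential_ge0 c minW Wap).
  - apply: aeW => x; apply: cvg_EFin; first exact: nearW.
    apply: cvgD; last exact: cvg_cst.
    apply: cvgM; last exact: cvg_cst.
    by apply: (cvg_comp _ _ (UV x)); exact: cW.
(* The infimum splits into the limiting kinetic energy and what remains for the potential; each
   bounds the matching term of [J V]. *)
have -> : j = \sum_(i < N) 2^-1 * kappa i + (j - \sum_(i < N) 2^-1 * kappa i) by ring.
rewrite EFinD; apply: leeD => //; rewrite -sumEFin; apply: lee_sum => i _.
by rewrite EFinM lee_pmul2l// lte_fin invr_gt0.
Qed.

Unset Implicit Arguments.

Theorem mainTheorem2 (R : realType) (N : nat) (W : 'rV[R]_N -> R)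
  (ap am : 'rV[R]_N) (r0 L c : R) :
  C2 W ->
  local_min W ap -> local_min W am ->
  W am < 0 -> W ap = 0 ->
  global_min W am ->
  compact [set u | W am <= W u /\ W u <= 0] ->
  0 < r0 ->
  (forall u, eucl_norm (u - ap) <= r0 -> 0 <= W u) ->
  (forall u, eucl_norm (u - am) <= r0 -> W u < 0) ->
  0 < L -> 0 < c ->
  exists UL : R -> 'rV[R]_N,
    XL ap am r0 L UL /\
    Ec W c UL = ereal_inf [set Ec W c V | V in XL ap am r0 L].
Proof.
move=> [cW _] _ _ Wam _ minW _ r00 Wap _ L0 c0.
have [V XV Vmin] := exists_shifted_minimizer cW Wam minW r00 Wap L0 c0.
exists V; split => //; apply/le_anti/andP; split; last first.
  by apply: ereal_inf_lbound; exists V.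
apply: le_ereal_inf_tmp => _ [U XU <-].
(* The same integral of [neg_bound] is subtracted on both sides, so the comparison is that of the
   shifted functionals. *)
rewrite (Ec_decomp cW Wam minW Wap c0 XV) (Ec_decomp cW Wam minW Wap c0 XU).
by apply: leeB => //; exact: Vmin.
Qed.
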